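(* Let $(X,u)$ be an ultrametric space whose value set $\Gamma$ is linearly ordered, and let $(X,\mathcal{B}_u)$ be its ultrametric ball space, $\mathcal{B}_u=\{B(x,y)\mid x,y\in X\}$. Then: (1) the ball space $(X,\mathcal{B}_u)$ is chain union stable; (2) if $(X,\mathcal{B}_u)$ is spherically complete, then so is $(X,\mathrm{cu}(\mathcal{B}_u))$.
   Context: A ball space $(X,\mathcal{B})$ is a nonempty set $X$ together with a nonempty collection $\mathcal{B}$ of nonempty subsets of $X$ (called balls). A chain in $\mathcal{B}$ is a nonempty subset of $\mathcal{B}$ that is linearly ordered by inclusion. The ball space is spherically complete if every chain in $\mathcal{B}$ has nonempty intersection. Define $\mathrm{cu}(\mathcal{B})=\{\bigcup\mathcal{C}\mid \emptyset\ne\mathcal{C}\subseteq\mathcal{B},\ \mathcal{C}\text{ is a chain}\}$. The ball space is chain union closed if $\mathrm{cu}(\mathcal{B})=\mathcal{B}$, and chain union stable if $(X,\mathrm{cu}(\mathcal{B}))$ is chain union closed. An ultrametric space $(X,u)$ with value set $\Gamma$ consists of a nonempty set $X$, a partially ordered set $\Gamma$ with smallest element $\bot$, and a function $u:X\times X\to\Gamma$ such that for all $x,y,z\in X$, $\gamma\in\Gamma$: (U1) $u(x,y)=\bot$ iff $x=y$; (U2) if $u(x,y)\le\gamma$ and $u(y,z)\le\gamma$ then $u(x,z)\le\gamma$; (U3) $u(x,y)=u(y,x)$. For $x,y\in X$, the (precise) ball is $B(x,y)=\{z\in X\mid u(x,z)\le u(x,y)\}$. The ultrametric ball space is $(X,\mathcal{B}_u)$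 with $\mathcal{B}_u=\{B(x,y)\mid x,y\in X\}$. *)

(* Defs.v *)
From HB Require Import structures.
From mathcomp Require Import all_boot all_order.
From mathcomp Require Import boolp classical_sets.

Set Implicit Arguments.
Unset Strict Implicit.
Unset Printing Implicit Defensive.

Import Order.TTheory.
Local Open Scope classical_set_scope.
Local Open Scope order_scope.

(* Nonemptiness of the carrier [X] follows from the two fields. *)
Record ball_space (X : Type) := BallSpace {
  balls :> set (set X);
  balls_neq0 : balls !=set0;
  ball_neq0 : forall b, balls b -> b !=set0
}.

Definition chain_in (X : Type) (B C : set (set X)) : Prop :=
  [/\ C !=set0, C `<=` B & total_on C (@subset X)].

Definition spherically_complete (X : Type) (B : ball_space X) : Prop :=
  forall C : set (set X), chain_in B C -> \bigcap_(b in C) b !=set0.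

Definition chain_unions (X : Type) (B : set (set X)) : set (set X) :=
  [set \bigcup_(b in C) b | C in [set C | chain_in B C]].

Lemma sub_chain_unions (X : Type) (B : set (set X)) : B `<=` chain_unions B.
Proof.
move=> b Bb; exists [set b]; last by rewrite bigcup_set1.
by split=> [|_ ->//|_ _ -> ->]; [exists b | left].
Qed.

Lemma chain_unions_neq0 (X : Type) (B : ball_space X) : chain_unions B !=set0.
Proof. by have [b Bb] := balls_neq0 B; exists b; exact: sub_chain_unions. Qed.

Lemma chain_union_neq0 (X : Type) (B : ball_space X) (b : set X) :
  chain_unions B b -> b !=set0.
Proof.
move=> [C [[c Cc] CB _] <-].
by have [x cx] := ball_neq0 (CB _ Cc); exists x, c.
Qed.

Definition cu (X : Type) (B : ball_space X) : ball_space X :=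
  BallSpace (chain_unions_neq0 B) (@chain_union_neq0 X B).

Definition chain_union_closed (X : Type) (B : ball_space X) : Prop :=
  balls (cu B) = balls B.

Definition chain_union_stable (X : Type) (B : ball_space X) : Prop :=
  chain_union_closed (cu B).

Record ultrametric (X : Type) (d : Order.disp_t) (Gamma : bPOrderType d) :=
  Ultrametric {
    udist :> X -> X -> Gamma;
    ultrametric_inhabited : inhabited X;
    udist_eq0 : forall x y, udist x y = \bot <-> x = y;
    udist_ultra : forall x y z (gamma : Gamma),
      udist x y <= gamma -> udist y z <= gamma -> udist x z <= gamma;
    udistC : forall x y, udist x y = udist y x
  }.

Section UltrametricBalls.
Variables (X : Type) (d : Order.disp_t) (Gamma : bPOrderType d).
Variable u : ultrametric X Gamma.

Definition uball (x y : X) : set X := [set z | u x z <= u x y].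

Definition uballs : set (set X) := [set b | exists x y, b = uball x y].

Lemma uballs_neq0 : uballs !=set0.
Proof. by have [x] := ultrametric_inhabited u; exists (uball x x), x, x. Qed.

Lemma uball_neq0 (b : set X) : uballs b -> b !=set0.
Proof. by move=> [x [y ->]]; exists y; rewrite /uball /=. Qed.

Definition ultrametric_ball_space : ball_space X :=
  BallSpace uballs_neq0 uball_neq0.

End UltrametricBalls.

(* Main.v *)
(** A nonempty set [b] is a union of a chain of balls iff it is ball-convex:
    [B(x,y)] lies in [b] whenever [x] and [y] do.  Indeed, for [x] in [b], the
    balls [B(x,y)] with [y] in [b] form a chain with union [b].  Ball-convexity
    passes to unions of chains, which gives (1).  For (2), take a chain [C] of
    ball-convex sets without smallest element.  The balls containing some member
    of [C] form a chain, since two meeting balls are comparable, and every member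
    of [C] contains such a ball: if [x] lies in [c'] and [y] in [c] but not in
    [c'], then [c'] is contained in [B(x,y)], itself contained in [c]. *)

Require Import Defs.
From mathcomp Require Import all_boot all_order.
From mathcomp Require Import boolp classical_sets.

Import Order.TTheory.
Local Open Scope classical_set_scope.
Local Open Scope order_scope.

Section BallConvex.
Set Implicit Arguments.
Unset Strict Implicit.
Context {X : Type} {d : Order.disp_t} {Gamma : bOrderType d}.
Variable u : ultrametric X Gamma.

Definition ball_convex (b : set X) : Prop :=
  forall x y, b x -> b y -> uball u x y `<=` b.

Lemma uball_center (x y : X) : uball u x y x.
Proof. by rewrite /uball /= (udist_eq0 u x x).2 // le0x. Qed.

Lemma uball_right (x y : X) : uball u x y y.
Proof. exact: lexx. Qed.

(** From [x2], any point [w] of the first ball is reached through [z] and then [x1], each step being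
    at most [u x2 y2]. *)
Lemma uball_sub (x1 y1 x2 y2 z : X) :
  uball u x1 y1 z -> uball u x2 y2 z -> u x1 y1 <= u x2 y2 ->
  uball u x1 y1 `<=` uball u x2 y2.
Proof.
rewrite /uball /= => x1z x2z le12 w /= x1w.
apply: (udist_ultra (y := z)) => //.
apply: (udist_ultra (y := x1)); last exact: le_trans x1w le12.
by rewrite udistC; exact: le_trans x1z le12.
Qed.

Lemma uballs_comparable (b1 b2 : set X) (z : X) :
  uballs u b1 -> uballs u b2 -> b1 z -> b2 z -> b1 `<=` b2 \/ b2 `<=` b1.
Proof.
move=> [x1 [y1 ->]] [x2 [y2 ->]] z1 z2.
case/orP: (le_total (u x1 y1) (u x2 y2)) => [le12|le21].
  by left; exact: uball_sub z1 z2 le12.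
by right; exact: uball_sub z2 z1 le21.
Qed.

(** The two balls share [x], so it suffices to compare radii; passing through the center [a] gives
    [u x y <= u a c]. *)
Lemma uball_convex (b : set X) : uballs u b -> ball_convex b.
Proof.
move=> [a [c ->]] x y ax ay; apply: (uball_sub (z := x)) => //.
  exact: uball_center.
by apply: (udist_ultra (y := a)) => //; rewrite udistC.
Qed.

(** Two points of the union lie together in a single member, the larger of the two that contain
    them. *)
Lemma ball_convex_bigcup (C : set (set X)) :
  C `<=` ball_convex -> total_on C (@subset X) ->
  ball_convex (\bigcup_(b in C) b).
Proof.
move=> Cconv Ctot x y [b1 Cb1 b1x] [b2 Cb2 b2y] z xyz.
case: (Ctot _ _ Cb1 Cb2) => [b12|b21].
  by exists b2 => //; apply: (Cconv _ Cb2 x y) xyz => //; exact: b12.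
by exists b1 => //; apply: (Cconv _ Cb1 x y) xyz => //; exact: b21.
Qed.

Lemma chain_unions_ballsP (b : set X) :
  chain_unions (uballs u) b <-> b !=set0 /\ ball_convex b.
Proof.
split=> [bcu | [[x bx] bconv]].
  split; first exact: (chain_union_neq0 (B := ultrametric_ball_space u)).
  case: bcu => C [_ CB Ctot] <-.
  by apply: ball_convex_bigcup => // c /CB; exact: uball_convex.
exists [set uball u x y | y in b].
  split; first by exists (uball u x x), x.
    by move=> _ [y _ <-]; exists x, y.
  move=> _ _ [y _ <-] [z _ <-].
  by apply: (uballs_comparable (z := x)); try exact: uball_center; do 2 eexists.
apply/seteqP; split=> [z [_ [y bY <-]]|z bz]; first exact: bconv.
by exists (uball u x z); [exists z | exact: uball_right].
Qed.

(** By linearity, a point [z] of [b] outside the ball has [u x y < u x z]; then [y] lies in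
    [uball u x z], hence in [b]. *)
Lemma ball_convex_sub_uball (b : set X) (x y : X) :
  ball_convex b -> b x -> ~ b y -> b `<=` uball u x y.
Proof.
move=> bconv bx nby z bz; rewrite /uball /=.
by case: leP => // /ltW xyz; case: nby; exact: bconv bx bz _ xyz.
Qed.

Lemma chain_union_stable_uballs :
  chain_union_stable (ultrametric_ball_space u).
Proof.
apply/seteqP; split; last exact: sub_chain_unions.
move=> b bcu; apply/chain_unions_ballsP; split.
  exact: (chain_union_neq0 (B := cu (ultrametric_ball_space u))).
case: bcu => C [_ CB Ctot] <-.
by apply: ball_convex_bigcup => // c /CB /chain_unions_ballsP[].
Qed.

Lemma spherically_complete_cu_uballs :
  spherically_complete (ultrametric_ball_space u) ->
  spherically_complete (cu (ultrametric_ball_space u)).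
Proof.
move=> sc C [[c0 Cc0] CB Ctot].
have Cneq0 c : C c -> c !=set0 by move=> /CB /chain_unions_ballsP[].
have Cconv c : C c -> ball_convex c by move=> /CB /chain_unions_ballsP[].
have [[m Cm mmin]|nomin] := pselect (exists2 m, C m & forall c, C c -> m `<=` c).
  by have [x mx] := Cneq0 _ Cm; exists x => c Cc; exact: mmin Cc _ mx.
pose D := [set b | uballs u b /\ exists2 c, C c & c `<=` b].
have DsubC c : C c -> exists2 b, D b & b `<=` c.
  (* Since [c] is not smallest, some member fails to contain it; totality then places that member
     inside [c]. *)
  move=> Cc; have [c' Cc' ncc'] : exists2 c', C c' & ~ c `<=` c'.
    apply: contrapT => H; apply: nomin; exists c => // c' Cc'.
    by apply: contrapT => ncc'; apply: H; exists c'.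
  have c'c : c' `<=` c by case: (Ctot _ _ Cc Cc').
  have [y cy nc'y] : exists2 y, c y & ~ c' y.
    apply: contrapT => H; apply: ncc' => y cy.
    by apply: contrapT => nc'y; apply: H; exists y.
  have [x c'x] := Cneq0 _ Cc'.
  exists (uball u x y); last by apply: Cconv => //; exact: c'c.
  split; first by exists x, y.
  by exists c' => //; apply: ball_convex_sub_uball => //; exact: Cconv.
have [] := sc D.
  split; first by have [b Db _] := DsubC _ Cc0; exists b.
    by move=> b [].
  move=> b1 b2 [Bb1 [c1 Cc1 c1b1]] [Bb2 [c2 Cc2 c2b2]].
  (* Both balls contain the smaller of [c1] and [c2], so they meet. *)
  case: (Ctot _ _ Cc1 Cc2) => [c12|c21].
    have [z cz] := Cneq0 _ Cc1.
    by apply: (uballs_comparable (z := z)) => //; [exact: c1b1 | exact/c2b2/c12].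
  have [z cz] := Cneq0 _ Cc2.
  by apply: (uballs_comparable (z := z)) => //; [exact/c1b1/c21 | exact: c2b2].
(* Each member of [C] contains a ball of [D], so a point common to [D] is common to [C]. *)
move=> x Dx; exists x => c Cc.
by have [b Db] := DsubC _ Cc; apply; exact: Dx.
Qed.

End BallConvex.

Theorem theorem1p3 (X : Type) (d : Order.disp_t) (Gamma : bOrderType d)
    (u : ultrametric X Gamma) :
  chain_union_stable (ultrametric_ball_space u) /\
  (spherically_complete (ultrametric_ball_space u) ->
   spherically_complete (cu (ultrametric_ball_space u))).
Proof.
split; first exact: chain_union_stable_uballs.
exact: spherically_complete_cu_uballs.
Qed.
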